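(* Let $n\ge 1$ be an integer, let $C$ be a nonempty convex subset of $\mathbb{R}^n$ and let $f:C\to\mathbb{R}$ be convex. Let $\lambda=(\lambda_1,\dots,\lambda_n)\in \mathrm{int}(E_n)$, and put $\lambda_{n+1}:=1-\sum_{i=1}^n\lambda_i$ and $\lambda_{n+2}:=\lambda_1$. For $i=1,\dots,n+1$ put $$\lambda_{i,n}:=\Big[\frac{n!\,\lambda_i}{\lambda_{i+1}}\Big]_{-n}-1,\qquad \tilde\lambda(i,n):=\sum_{j=1,\,j\ne i}^{n+1}\frac{\lambda_{j+1}}{\lambda_{j,n}+n+1}+\lambda_{i+1}\frac{\lambda_{i,n}+1}{\lambda_{i,n}+n+1},$$ and let $\nu_\lambda$ be the probability measure on $E_n$ defined by $$d\nu_\lambda(t):=n!\sum_{i=1}^{n+1}\lambda_i\,t_i^{\lambda_{i,n}}\,dt .$$ Then for all $(a_1,\dots,a_{n+1})\in C^{n+1}$, $$f\Big(\sum_{i=1}^{n+1}\tilde\lambda(i,n)a_i\Big)\le\int_{E_n}f\Big(\sum_{i=1}^{n+1}t_ia_i\Big)\,d\nu_\lambda(t)\le\sum_{i=1}^{n+1}\tilde\lambda(i,n)f(a_i).$$ If instead $f$ is concave, both inequalities are reversed.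
   Context: $E_n:=\{(t_1,\dots,t_n)\in\mathbb{R}^n: t_i\ge 0\ (i=1,\dots,n),\ \sum_{i=1}^n t_i\le 1\}$ is the standard simplex, and $\mathrm{int}(E_n)=\{(t_1,\dots,t_n): t_i>0\ (i=1,\dots,n),\ \sum_{i=1}^n t_i<1\}$ is its interior. For $t=(t_1,\dots,t_n)\in E_n$, $t_{n+1}:=1-\sum_{i=1}^n t_i$, and $dt:=dt_1\cdots dt_n$ is Lebesgue measure on $\mathbb{R}^n$. For an integer $k\ge1$ and real $x>0$, $(x)_k:=\Gamma(x+k)/\Gamma(x)=x(x+1)\cdots(x+k-1)$. For real $c>0$, $[c]_{-k}$ denotes the unique $x>0$ with $(x)_k=c$. *)

(* Defs.v *)
From HB Require Import structures.
From mathcomp Require Import all_boot all_order all_algebra.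
From mathcomp Require Import all_classical all_reals all_analysis.
From mathcomp Require Import measurable_realfun.

Set Implicit Arguments.
Unset Strict Implicit.
Unset Printing Implicit Defensive.

Import Order.TTheory GRing.Theory Num.Theory.
Import numFieldNormedType.Exports.

Local Open Scope classical_set_scope.
Local Open Scope ring_scope.
Local Open Scope convex_scope.

(* R^n as a measurable space: the library equips tuples with the product
   sigma-algebra, i.e. the Borel sigma-algebra of R^n. *)
Notation measurable_Rn R n := (n.-tuple (measurableTypeR R)).

Section lebesgue_measure_step.
Local Open Scope ereal_scope.
Context (R : realType) (n : nat).
Variable m : {sigma_finite_measure set (measurable_Rn R n) -> \bar R}.

Definition tuple_cons (p : measurableTypeR R * measurable_Rn R n) :
  measurable_Rn R n.+1 := [tuple of p.1 :: p.2].

Lemma measurable_tuple_cons : measurable_fun setT tuple_cons.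
Proof. exact: measurable_cons. Qed.

Definition lebesgue_step : set (measurable_Rn R n.+1) -> \bar R :=
  pushforward (@lebesgue_measure R \x m) tuple_cons.

Let step0 : lebesgue_step set0 = 0.
Proof. by rewrite /lebesgue_step /pushforward preimage_set0 measure0. Qed.

Let step_ge0 A : 0 <= lebesgue_step A.
Proof. by rewrite /lebesgue_step /pushforward measure_ge0. Qed.

Let step_sigma_additive : semi_sigma_additive lebesgue_step.
Proof.
move=> F mF tF mUF; rewrite /lebesgue_step /pushforward preimage_bigcup.
apply: measure_semi_sigma_additive.
- by move=> k; rewrite -[X in measurable X]setTI; exact: measurable_tuple_cons.
- apply/trivIsetP => /= i j _ _ ij; rewrite -preimage_setI.
  by move/trivIsetP : tF => /(_ _ _ _ _ ij) ->//; rewrite preimage_set0.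
- by rewrite -preimage_bigcup -[X in measurable X]setTI;
     exact: measurable_tuple_cons.
Qed.

HB.instance Definition _ := isMeasure.Build _ _ _ lebesgue_step
  step0 step_ge0 step_sigma_additive.

Let step_sigma_finite : sigma_finite setT lebesgue_step.
Proof.
have /sigma_finiteP[F [TF ndF Foo]] := sigma_finiteT (@lebesgue_measure R).
have /sigma_finiteP[G [TG ndG Goo]] := sigma_finiteT m.
pose g (t : measurable_Rn R n.+1) : measurableTypeR R * measurable_Rn R n :=
  (tnth t ord0, [tuple of behead t]).
have mg : measurable_fun setT g.
  apply/measurable_fun_pair => /=; first exact: measurable_tnth.
  exact: measurable_behead.
have gK : cancel tuple_cons g.
  by case=> x t; rewrite /g /tuple_cons /= tnth0; congr pair; exact: val_inj.
exists (fun k => g @^-1` (F k `*` G k)).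
  apply/seteqP; split=> // t _.
  have [i _ Fi] : (\bigcup_k F k) (g t).1 by rewrite -TF.
  have [j _ Gj] : (\bigcup_k G k) (g t).2 by rewrite -TG.
  exists (maxn i j) => //; split.
  - by move: Fi; exact/subsetPset/ndF/leq_maxl.
  - by move: Gj; exact/subsetPset/ndG/leq_maxr.
move=> k; have [mFk Fkoo] := Foo k; have [mGk Gkoo] := Goo k; split.
  by rewrite -[X in measurable X]setTI; apply: mg => //; exact: measurableX.
rewrite /lebesgue_step /pushforward.
have -> : tuple_cons @^-1` (g @^-1` (F k `*` G k)) = F k `*` G k.
  by apply/funext => x; rewrite /preimage /mkset gK.
by rewrite product_measure1E// lte_mul_pinfty// ge0_fin_numE.
Qed.

HB.instance Definition _ := Measure_isSigmaFinite.Build _ _ _ lebesgue_step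
  step_sigma_finite.

End lebesgue_measure_step.

(* The n-fold product of the one-dimensional Lebesgue measure; [dirac] at the
   empty tuple is the unit mass of the one-point space R^0. *)
Fixpoint lebesgue_Rn (R : realType) (n : nat) :
    {sigma_finite_measure set (measurable_Rn R n) -> \bar R} :=
  match n with
  | 0 => \d_([tuple] : measurable_Rn R 0)
  | k.+1 => lebesgue_step (lebesgue_Rn R k)
  end.

Lemma lebesgue_Rn_box (R : realType) (n : nat)
    (A : 'I_n -> set (measurableTypeR R)) :
  (forall i, measurable (A i)) ->
  lebesgue_Rn R n [set t | forall i, A i (tnth t i)] =
  (\prod_(i < n) lebesgue_measure (A i))%E.
Proof.
elim: n A => [|n IH] A mA.
  rewrite big_ord0 /= diracE mem_set// => -[].
  by case.
rewrite big_ord_recl -IH => [|i]; last exact: mA.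
rewrite /= /lebesgue_step /pushforward -product_measure1E//.
- congr (_ _); apply/seteqP; split=> [[x t]/= At|[x t]/= [Ax At] i].
    split=> /=; first by have := At ord0; rewrite tnth0.
    by move=> i; have := At (lift ord0 i); rewrite tnthS.
  case: (unliftP ord0 i) => [j ->|->]; last by rewrite tnth0.
  by rewrite tnthS.
- rewrite (_ : [set _ | _] = \bigcap_(i in [set: 'I_n])
    ((fun t : measurable_Rn R n => tnth t i) @^-1` A (lift ord0 i))); last first.
    by apply/seteqP; split=> t /= h i; [move=> _; exact: h|exact: h].
  apply: fin_bigcap_measurable => // i _.
  rewrite -[X in measurable X]setTI; exact: measurable_tnth.
Qed.

Section simplex.
Context (R : realType) (n : nat).

Definition simplex : set (measurable_Rn R n) :=
  [set t | (forall i, 0 <= tnth t i) /\ \sum_(i < n) tnth t i <= 1].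

Definition simplex_interior : set (measurable_Rn R n) :=
  [set t | (forall i, 0 < tnth t i) /\ \sum_(i < n) tnth t i < 1].

(* Indices are shifted by one: [bary t i] is t_(i+1) for i = 0, ..., n, where
   the default value of [nth], reached only at i = n, is t_(n+1). *)
Definition bary (t : measurable_Rn R n) (i : 'I_n.+1) : R :=
  nth (1 - \sum_(j < n) tnth t j) t i.

End simplex.
Arguments simplex : clear implicits.

Definition rising_factorial (R : realType) (x : R) (k : nat) : R :=
  \prod_(i < k) (x + i%:R).

(* [c]_{-k}; the default value 0 of [xget] is irrelevant for c > 0 and k > 0,
   see [inv_rising_factorialP] and [rising_factorial_inj]. *)
Definition inv_rising_factorial (R : realType) (c : R) (k : nat) : R :=
  xget 0 [set x | 0 < x /\ rising_factorial x k = c].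

Section inv_rising_factorial.
Context (R : realType).

Lemma rising_factorial_lt (k : nat) (x y : R) : (0 < k)%N ->
  0 < x -> x < y -> rising_factorial x k < rising_factorial y k.
Proof.
case: k => // k _ x0 xy; rewrite /rising_factorial.
apply: ltr_prod => [|i _]; first by apply/hasP; exists ord0 => //; rewrite mem_index_enum.
by rewrite ltrD2r xy andbT addr_ge0// ltW.
Qed.

Lemma rising_factorial_inj (k : nat) (x y : R) : (0 < k)%N -> 0 < x -> 0 < y ->
  rising_factorial x k = rising_factorial y k -> x = y.
Proof.
move=> k0 x0 y0 xy; case: (ltgtP x y) => // h.
- by have := rising_factorial_lt k0 x0 h; rewrite xy ltxx.
- by have := rising_factorial_lt k0 y0 h; rewrite xy ltxx.
Qed.

Lemma inv_rising_factorialP (c : R) (k : nat) : 0 < c -> (0 < k)%N ->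
  0 < inv_rising_factorial c k /\
  rising_factorial (inv_rising_factorial c k) k = c.
Proof.
case: k => // k c0 _.
suff [x [x0 xc]] : exists x : R, 0 < x /\ rising_factorial x k.+1 = c.
  by rewrite /inv_rising_factorial; case: xgetP => [y _ //|/(_ x)[]].
pose p : {poly R} := \prod_(i < k.+1) ('X + (i%:R)%:P).
have pE (x : R) : p.[x] = rising_factorial x k.+1.
  by rewrite horner_prod; apply: eq_bigr => i _; rewrite !hornerE.
have p0 : p.[0] = 0.
  by rewrite pE /rising_factorial big_ord_recl addr0 mul0r.
have cp : c <= p.[c + 1].
  rewrite pE /rising_factorial big_ord_recl addr0.
  apply: (@le_trans _ _ (c + 1)); first by rewrite lerDl.
  have c10 : 0 <= c + 1 by rewrite addr_ge0 ?ltW.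
  rewrite ler_peMr//.
  apply: (big_ind (fun x : R => 1 <= x)) => // [x y x1 y1|i _].
    by rewrite (le_trans x1)// ler_peMr// (le_trans ler01).
  by rewrite addrAC lerDr addr_ge0// ltW.
have [|||x] := @IVT R (fun x => p.[x]) 0 (c + 1) c.
- by rewrite addr_ge0 ?ltW.
- by apply: continuous_subspaceT => x; exact: continuous_horner.
- by rewrite p0 minElt maxElt (lt_le_trans c0 cp) ltW.
rewrite in_itv/= => /andP[x0 _] pxc.
exists x; split; last by rewrite -pE.
rewrite lt_neqAle x0 andbT; apply/eqP => x0'.
by move: c0; rewrite -pxc -x0' p0 ltxx.
Qed.

End inv_rising_factorial.

Section weights.
Context (R : realType) (n : nat) (lam : measurable_Rn R n).

(* lambda_(i,n); [ordS] is the cyclic successor on 'I_n.+1, which encodes the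
   convention lambda_(n+2) = lambda_1. *)
Definition simplex_exponent (i : 'I_n.+1) : R :=
  inv_rising_factorial (n`!%:R * bary lam i / bary lam (ordS i)) n - 1.

Definition simplex_weight (i : 'I_n.+1) : R :=
  \sum_(j < n.+1 | j != i)
     bary lam (ordS j) / (simplex_exponent j + n%:R + 1)
  + bary lam (ordS i) *
     ((simplex_exponent i + 1) / (simplex_exponent i + n%:R + 1)).

(* [0 `^ r] is 0 for r <> 0, including r < 0; this only affects the density on
   the boundary of the simplex, which is Lebesgue-negligible. *)
Definition simplex_density (t : measurable_Rn R n) : R :=
  n`!%:R * \sum_(i < n.+1) bary lam i * bary t i `^ simplex_exponent i.

Lemma bary_gt0 : simplex_interior lam -> forall i, 0 < bary lam i.
Proof.
move=> [lam0 lam1] i; rewrite /bary; have [ni|ni] := ltnP i n.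
  rewrite (set_nth_default 0) ?size_tuple//.
  by have := lam0 (Ordinal ni); rewrite (tnth_nth 0).
by rewrite nth_default ?size_tuple// subr_gt0.
Qed.

Lemma simplex_density_ge0 (t : measurable_Rn R n) :
  simplex_interior lam -> 0 <= simplex_density t.
Proof.
move=> hlam; rewrite mulr_ge0// sumr_ge0// => i _.
by rewrite mulr_ge0 ?powR_ge0// ltW// bary_gt0.
Qed.

Lemma measurable_bary (i : 'I_n.+1) :
  measurable_fun setT (fun t : measurable_Rn R n => bary t i).
Proof.
have [ni|ni] := ltnP i n.
  rewrite (_ : (fun _ => _) = fun t : measurable_Rn R n => tnth t (Ordinal ni)).
    exact: measurable_tnth.
  apply/funext => t; rewrite /bary (set_nth_default 0) ?size_tuple//.
  by rewrite (tnth_nth 0).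
rewrite (_ : (fun _ => _) =
  fun t : measurable_Rn R n => 1 - \sum_(j < n) tnth t j); last first.
  by apply/funext => t; rewrite /bary nth_default ?size_tuple.
apply: measurable_funB => //.
by apply: measurable_sum => j; exact: measurable_tnth.
Qed.

Lemma measurable_simplex_density : measurable_fun setT simplex_density.
Proof.
apply: measurable_funM => //; apply: measurable_sum => i.
apply: measurable_funM => //.
apply: (measurableT_comp (measurable_powR _)); exact: measurable_bary.
Qed.

Lemma measurable_simplex : measurable (simplex R n).
Proof.
rewrite (_ : simplex R n = (\bigcap_(i in [set: 'I_n])
    ((fun t : measurable_Rn R n => tnth t i) @^-1` `[0, +oo[%classic)) `&`
    ((fun t : measurable_Rn R n => \sum_(j < n) tnth t j) @^-1`
     `]-oo, 1]%classic)); last first.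
  apply/seteqP; split=> t /=.
    by move=> [t0 t1]; split=> [i _|]; rewrite /= in_itv/= ?andbT.
  move=> [t0]; rewrite in_itv/= => t1; split=> // i.
  by have := t0 i Logic.I; rewrite /= in_itv/= andbT.
apply: measurableI.
  apply: fin_bigcap_measurable => // i _.
  by rewrite -[X in measurable X]setTI; exact: measurable_tnth.
rewrite -[X in measurable X]setTI.
have : measurable_fun setT
  (fun t : measurable_Rn R n => \sum_(j < n) tnth t j : measurableTypeR R).
  by apply: measurable_sum => j; exact: measurable_tnth.
exact.
Qed.

End weights.

Section simplex_measure.
Local Open Scope ereal_scope.
Context (R : realType) (n : nat) (lam : measurable_Rn R n).
Hypothesis hlam : simplex_interior lam.

Definition simplex_measure of simplex_interior lam :
    set (measurable_Rn R n) -> \bar R :=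
  fun A => \int[lebesgue_Rn R n]_(t in A `&` simplex R n)
             (simplex_density lam t)%:E.

Let nu0 : simplex_measure hlam set0 = 0.
Proof. by rewrite /simplex_measure set0I integral_set0. Qed.

Let nu_ge0 A : 0 <= simplex_measure hlam A.
Proof.
by apply: integral_ge0 => t _; rewrite lee_fin simplex_density_ge0.
Qed.

Let nu_sigma_additive : semi_sigma_additive (simplex_measure hlam).
Proof.
move=> F mF tF mUF; rewrite /simplex_measure; apply: cvg_toP.
  apply: ereal_nondecreasing_is_cvgn => k l kl.
  apply: lee_sum_nneg_natr => // i _ _.
  by apply: integral_ge0 => t _; rewrite lee_fin simplex_density_ge0.
rewrite setI_bigcupl ge0_integral_bigcup//=.
- by move=> k; apply: measurableI => //; exact: measurable_simplex.
- apply: measurable_funTS; apply/measurable_EFinP.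
  exact: measurable_simplex_density.
- by move=> t _; rewrite lee_fin simplex_density_ge0.
- exact: trivIset_setIr.
Qed.

HB.instance Definition _ := isMeasure.Build _ _ _ (simplex_measure hlam)
  nu0 nu_ge0 nu_sigma_additive.

End simplex_measure.

(* The library only has [convex_function]. *)
Definition concave_function (R : numFieldType) (E : lmodType R)
    (E' := convex_lmodType E) (D : set E') (f : E' -> R^o) :=
  forall t : {i01 R},
    {in D &, forall x y : E', (f x <| t |> f y <= f (x <| t |> y))%R}.

(* Main.v *)
(* As [int_(E_n) t_i^p dt = 1 / (p + 1)_n], the exponents are chosen so that
   [nu_lambda] has mass [sum lambda_(i+1) = 1]; its barycenter, another Dirichlet
   integral with a single non-integral exponent, is the point with coordinates
   [tilde lambda (i, n)].  With [G t = f (sum t_i a_i)], the upper bound is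
   [G t <= sum t_i f (a_i)] integrated, and the lower bound is Jensen's
   inequality: the barycenter is interior to the simplex, so [G] has an affine
   minorant touching it there, by a finite-dimensional Hahn-Banach argument.
   [G] may be discontinuous on the boundary, but a convex function on a simplex
   is upper semicontinuous and bounded, hence integrable. *)

Require Import Defs.
From HB Require Import structures.
From mathcomp Require Import all_boot all_order all_algebra.
From mathcomp Require Import all_classical all_reals all_analysis.
From mathcomp Require Import measurable_realfun.
From mathcomp Require Import ring lra.

Set Implicit Arguments.
Unset Strict Implicit.
Unset Printing Implicit Defensive.

Import Order.TTheory GRing.Theory Num.Theory.
Import numFieldNormedType.Exports.

Local Open Scope classical_set_scope.
Local Open Scope ring_scope.

(** * Convex functions in barycentric coordinates *)

Section hahn_banach_fin.
Context (R : realType).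

Definition sublinear_on (V : lmodType R) (K : set V) (p : V -> R) :=
  (forall x y, K x -> K y -> p (x + y) <= p x + p y) /\
  (forall (c : R) x, 0 <= c -> K x -> p (c *: x) = c * p x).

Definition convex_cone (V : lmodType R) (K : set V) :=
  (forall x y, K x -> K y -> K (x + y)) /\
  (forall (c : R) x, 0 <= c -> K x -> K (c *: x)).

(* The new functional is [v |-> inf_(s >= 0) (p (v + s u) - s p u)]. *)
Lemma sublinear_linearize (V : lmodType R) (K : set V) (p : V -> R) (u : V) :
  convex_cone K -> sublinear_on K p -> K u ->
  (forall v, exists2 s : R, 0 <= s & K (v + s *: u)) ->
  exists q : V -> R, [/\ sublinear_on setT q, forall v, K v -> q v <= p v
    & q (- u) <= - p u].
Proof.
move=> [KD KZ] [pD pZ] Ku Kabs.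
pose S v :=
  [set p (v + s *: u) - s * p u | s in [set s | 0 <= s /\ K (v + s *: u)]].
have SP v (s : R) : 0 <= s -> K (v + s *: u) -> S v (p (v + s *: u) - s * p u).
  by move=> s0 Ks; exists s.
have lbS v : has_inf (S v).
  split.
    have [s s0 Ks] := Kabs v; exists (p (v + s *: u) - s * p u); exact: SP.
  (* The lower bound does not depend on [s]: [v + s u] and [-v + r u] add up to [(s + r) u], where
     [p] equals [(s + r) p u]. *)
  have [r r0 Kr] := Kabs (- v).
  exists (r * p u - p (- v + r *: u)) => _ [s [s0 Ks] <-].
  have := pD _ _ Ks Kr.
  rewrite addrACA subrr add0r -scalerDl pZ ?addr_ge0//; lra.
pose q v := inf (S v).
have q_le v (s : R) : 0 <= s -> K (v + s *: u) ->
    q v <= p (v + s *: u) - s * p u.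
  by move=> s0 Ks; apply: ge_inf; [exact: (lbS v).2|exact: SP].
have q_ge v (x : R) : (forall s : R, 0 <= s -> K (v + s *: u) ->
    x <= p (v + s *: u) - s * p u) -> x <= q v.
  move=> h; apply: lb_le_inf; first exact: (lbS v).1.
  by move=> _ [s [s0 Ks] <-]; exact: h.
(* Only one inequality is shown here; the other follows from it with [c^-1] and [c *: x] in place of
   [c] and [v]. *)
have qZ_ge (c : R) v : 0 < c -> c * q v <= q (c *: v).
  move=> c0; apply: (q_ge _ _) => s s0 Ks.
  have Ec : c^-1 *: (c *: v + s *: u) = v + (c^-1 * s) *: u.
    by rewrite scalerDr !scalerA mulVf ?gt_eqF// scale1r.
  have := q_le v (c^-1 * s); rewrite -Ec => /(_ _ _)/wrap[].
  - by rewrite mulr_ge0// invr_ge0 ltW.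
  - by apply: KZ => //; rewrite invr_ge0 ltW.
  rewrite pZ ?invr_ge0 ?(ltW c0)// -mulrA -mulrBr -(ler_pM2l c0) mulrA mulfV ?gt_eqF//.
  by rewrite mul1r.
have q0 : q 0 = 0.
  apply/eqP; rewrite eq_le; apply/andP; split.
    have := q_le 0 0 (lexx _); rewrite scale0r addr0 mul0r subr0.
    have K0 : K 0 by rewrite -(scale0r u); exact: KZ.
    by move=> /(_ K0); rewrite -(scale0r u) pZ// mul0r.
  by apply: (q_ge _ _) => s s0 _; rewrite add0r pZ// subrr.
exists q; split; [split|move=> v Kv|].
- move=> x y _ _; rewrite -lerBlDr; apply: (q_ge x) => s s0 Ks.
  rewrite lerBlDr -lerBlDl; apply: (q_ge y) => r r0 Kr.
  rewrite lerBlDl.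
  have Exy : x + y + (s + r) *: u = (x + s *: u) + (y + r *: u).
    by rewrite scalerDl addrACA.
  have := q_le (x + y) (s + r).
  rewrite Exy => /(_ (addr_ge0 s0 r0) (KD _ _ Ks Kr)).
  have := pD _ _ Ks Kr; lra.
- move=> c x; rewrite le_eqVlt => /predU1P[<- _|c0 _].
    by rewrite scale0r mul0r.
  apply/eqP; rewrite eq_le qZ_ge// andbT.
  have := qZ_ge c^-1 (c *: x); rewrite invr_gt0 => /(_ c0).
  rewrite scalerA mulVf ?gt_eqF// scale1r -(ler_pM2l c0) mulrA.
  by rewrite mulfV ?gt_eqF// mul1r.
- by have := q_le v 0 (lexx _); rewrite scale0r addr0 mul0r subr0; exact.
(* At [s = 1] the argument of [p] is 0, which leaves [- p u]. *)
- have := q_le (- u) 1 ler01; rewrite scale1r addNr mul1r.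
  have K0 : K 0 by rewrite -(scale0r u); exact: KZ.
  move=> /(_ K0)/le_trans; apply.
  by rewrite -(scale0r u) pZ// mul0r sub0r.
Qed.

Lemma sublinear_ge_opp (V : lmodType R) (q : V -> R) v :
  sublinear_on setT q -> - q v <= q (- v).
Proof.
move=> [qD qZ]; have := qD v (- v) Logic.I Logic.I; rewrite subrr.
have -> : q 0 = 0 by rewrite -(scale0r v) qZ// mul0r.
lra.
Qed.

(** The condition [q' (- v) <= - q' v] makes [q'] linear along [v]. Vectors are treated one at a
    time, and decreasing [q1] to [q2] keeps what was gained:
    [q2 (- v) <= q1 (- v) <= - q1 v <= - q2 v]. *)
Lemma sublinear_ge_linear (V : lmodType R) (q : V -> R) (s : seq V) :
  sublinear_on setT q ->
  exists q' : V -> R, [/\ sublinear_on setT q', forall v, q' v <= q v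
    & forall v, v \in s -> q' (- v) <= - q' v].
Proof.
move=> qs; elim: s => [|u s [q1 [q1s q1q q1l]]]; first by exists q; split.
have [||||q2 [q2s q2q1 q2u]] := @sublinear_linearize V setT q1 u.
- by split.
- exact: q1s.
- by [].
- by move=> v; exists 0.
have {}q2q1 v : q2 v <= q1 v by exact: q2q1.
exists q2; split=> // [v|v]; first exact: le_trans (q1q v).
rewrite inE => /predU1P[->|vs].
  by rewrite (le_trans q2u)// lerN2.
by rewrite (le_trans (q2q1 _))// (le_trans (q1l _ vs))// lerN2.
Qed.

Lemma sublinear_opp_scale (V : lmodType R) (q : V -> R) (v : V) (c : R) :
  sublinear_on setT q -> q (- v) <= - q v -> q (c *: v) = c * q v.
Proof.
move=> qs qv; have [qD qZ] := qs.
have [c0|c0] := leP 0 c; first exact: qZ.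
have qvE : q (- v) = - q v.
  by apply/eqP; rewrite eq_le qv sublinear_ge_opp.
rewrite -[c]opprK scaleNr -scalerN qZ ?qvE ?mulrNN ?mulNr ?opprK//.
by rewrite oppr_ge0 ltW.
Qed.

(** Linearizing along [u] extends the problem from [K] to the whole space, and the bound at [- u]
    preserves contact with [p] at [u]. Linearizing then along the standard basis gives a linear
    form, whose coefficients are its values on that basis. *)
Lemma hahn_banach_row m (K : set 'rV[R]_m) (p : 'rV[R]_m -> R) (u : 'rV[R]_m) :
  convex_cone K -> sublinear_on K p -> K u ->
  (forall v : 'rV[R]_m, exists2 s : R, 0 <= s & K (v + s *: u)) ->
  exists l : 'I_m -> R, (forall v, K v -> \sum_i l i * v 0 i <= p v) /\
    \sum_i l i * u 0 i = p u.
Proof.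
move=> Kc ps Ku Kabs.
have [q [qs qp qu]] := sublinear_linearize Kc ps Ku Kabs.
have [q' [q's q'q q'l]] := sublinear_ge_linear [seq delta_mx 0 i | i : 'I_m] qs.
have dl i : q' (- delta_mx 0 i) <= - q' (delta_mx 0 i).
  by apply: q'l; apply: map_f; rewrite mem_enum.
have [q'D q'Z] := q's.
have q'_le (v : 'rV[R]_m) : q' v <= \sum_i q' (delta_mx 0 i) * v 0 i.
  rewrite [X in q' X]row_sum_delta.
  elim/big_ind2: _ => [||i _].
  - by rewrite -(scale0r 0) q'Z// mul0r.
  - move=> x x' y y' xx' yy'; rewrite (le_trans (q'D _ _ _ _))//; exact: lerD.
  - by rewrite sublinear_opp_scale// mulrC.
have q'E (v : 'rV[R]_m) : \sum_i q' (delta_mx 0 i) * v 0 i = q' v.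
  apply/eqP; rewrite eq_le q'_le andbT.
  have := sublinear_ge_opp (- v) q's; rewrite opprK; apply: le_trans.
  rewrite lerNr (le_trans (q'_le _))// -sumrN ler_sum// => i _.
  by rewrite mxE mulrN.
exists (fun i => q' (delta_mx 0 i)); split=> [v Kv|]; rewrite q'E.
  exact: le_trans (q'q _) (qp _ Kv).
apply/eqP; rewrite eq_le (le_trans (q'q _) (qp _ Ku))/=.
have := sublinear_ge_opp u q's.
have := le_trans (q'q (- u)) qu; lra.
Qed.

End hahn_banach_fin.

Section convex_combination.
Context (R : realType).

Definition barycentric m : set 'rV[R]_m :=
  [set b | (forall i, 0 <= b 0 i) /\ \sum_i b 0 i = 1].

Lemma convexP (V : lmodType R) (C : set V) :
  convex_set C -> forall (c : R) x y, 0 <= c <= 1 -> C x -> C y ->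
  C (c *: x + (1 - c) *: y).
Proof.
move=> Cc c x y /andP[c0 c1] Cx Cy.
have /(_ x y (Itv01 c0 c1)) := Cc; rewrite !inE => /(_ Cx Cy).
by [].
Qed.

Lemma convex_set_sum (V : lmodType R) (C : set V) : convex_set C ->
  forall m (b : 'I_m -> R) (a : 'I_m -> V), (forall i, 0 <= b i) ->
  \sum_i b i = 1 -> (forall i, C (a i)) -> C (\sum_i b i *: a i).
Proof.
move=> Cc; elim=> [|m IH] b a b0 b1 Ca.
  by move: b1; rewrite big_ord0 => /eqP; rewrite eq_sym oner_eq0.
move: b1; rewrite !big_ord_recl /=.
set B := \sum_(i < m) _ => bB1.
have B0 : 0 <= B by apply: sumr_ge0.
(* The other weights are to be renormalized by [B]; if [B = 0], they all vanish and only the first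
   point remains. *)
have [BE|Bn0] := eqVneq B 0.
  have bz (i : 'I_m) : b (lift ord0 i) = 0.
    apply/eqP; move/eqP: BE; rewrite psumr_eq0// => /allP; apply.
    by rewrite mem_index_enum.
  rewrite big1 => [|i _]; last by rewrite bz scale0r.
  by rewrite addr0; move: bB1; rewrite BE addr0 => ->; rewrite scale1r.
have -> : \sum_(i < m) b (lift ord0 i) *: a (lift ord0 i) =
    (1 - b ord0) *: \sum_(i < m) (b (lift ord0 i) / B) *: a (lift ord0 i).
  rewrite scaler_sumr; apply: eq_bigr => i _; rewrite scalerA; congr (_ *: _).
  have -> : 1 - b ord0 = B by rewrite -bB1 addrAC subrr add0r.
  by rewrite mulrC divfK.
apply: convexP => //.
- by rewrite b0 -bB1 lerDl.
- apply: IH => // [i|]; first by rewrite divr_ge0.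
  by rewrite -mulr_suml divff.
Qed.

Lemma convex_function_le (V : lmodType R) (C : set V) (f : V -> R) :
  convex_function C f -> forall (c : R) x y, 0 <= c <= 1 -> C x -> C y ->
  f (c *: x + (1 - c) *: y) <= c * f x + (1 - c) * f y.
Proof.
move=> fc c x y /andP[c0 c1] Cx Cy.
have /(_ (Itv01 c0 c1) x y) := fc; rewrite !inE => /(_ Cx Cy).
by [].
Qed.

(* Apply [convex_set_sum] to the epigraph of [f]. *)
Lemma convex_function_sum (V : lmodType R) (C : set V) (f : V -> R) m
    (b : 'I_m -> R) (a : 'I_m -> V) : convex_set C -> convex_function C f ->
  (forall i, 0 <= b i) -> \sum_i b i = 1 -> (forall i, C (a i)) ->
  f (\sum_i b i *: a i) <= \sum_i b i * f (a i).
Proof.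
move=> Cc fc b0 b1 Ca.
pose E : set (V * R^o)%type := [set z | C z.1 /\ f z.1 <= z.2].
have Ec : convex_set E.
  move=> z w t; rewrite !inE => -[Cz fz] [Cw fw].
  have t01 : 0 <= t%:inum <= 1 by rewrite ge0 le1.
  split; first exact: convexP.
  apply: (le_trans (convex_function_le fc t01 Cz Cw)).
  by apply: lerD; apply: ler_wpM2l => //; rewrite subr_ge0; case/andP: t01.
have := @convex_set_sum _ E Ec m b (fun i => (a i, f (a i) : R^o)) b0 b1.
have Ea i : E (a i, f (a i) : R^o) by split=> /=; [exact: Ca|exact: lexx].
move=> /(_ Ea)[_].
have -> : \sum_i b i *: ((a i, f (a i) : R^o) : V * R^o) =
  (\sum_i b i *: a i, \sum_i b i * f (a i) : R^o).
  by elim/big_ind3: _ => //= [? ? ? ? ? ? -> ->].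
by [].
Qed.

End convex_combination.

Section simplex_convex.
Context (R : realType) (m : nat) (G : 'rV[R]_m -> R).
Hypothesis Gconv : forall (c : R) x y, 0 <= c <= 1 ->
  barycentric x -> barycentric y ->
  G (c *: x + (1 - c) *: y) <= c * G x + (1 - c) * G y.

Lemma barycentric_gt0 : (exists b, @barycentric R m b) -> (0 < m)%N.
Proof.
move=> [b [_]]; case: m b => // b; rewrite big_ord0 => /eqP.
by rewrite eq_sym oner_eq0.
Qed.

(** Hahn-Banach is applied to the perspective [p] of [G], its positively homogeneous extension to
    the orthant [K]; convexity of [G] becomes subadditivity of [p]. Positivity of [w] makes the
    orthant absorbing in direction [w]. A linear form is enough as minorant, since a constant term
    is absorbed by [\sum_i b 0 i = 1]. *)
Lemma barycentric_subgradient w : barycentric w -> (forall i, 0 < w 0 i) ->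
  exists l : 'I_m -> R,
    (forall b, barycentric b -> \sum_i l i * b 0 i <= G b) /\
    \sum_i l i * w 0 i = G w.
Proof.
move=> [w0 w1] wpos.
pose K : set 'rV[R]_m := [set v | forall i, 0 <= v 0 i].
pose sg (v : 'rV[R]_m) : R := \sum_i v 0 i.
pose p v := sg v * G ((sg v)^-1 *: v).
have sgD x y : sg (x + y) = sg x + sg y.
  by rewrite -big_split; apply: eq_bigr => i _; rewrite mxE.
have sgZ c x : sg (c *: x) = c * sg x.
  by rewrite mulr_sumr; apply: eq_bigr => i _; rewrite mxE.
have sg_ge0 x : K x -> 0 <= sg x by move=> Kx; apply: sumr_ge0.
have sg_eq0 x : K x -> sg x = 0 -> x = 0.
  move=> Kx /eqP; rewrite psumr_eq0// => /allP x0; apply/rowP => i.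
  by rewrite mxE; apply/eqP; apply: x0; rewrite mem_index_enum.
have Kbary x : K x -> sg x != 0 -> barycentric ((sg x)^-1 *: x).
  move=> Kx x0; split=> [i|]; first by rewrite mxE mulr_ge0 ?invr_ge0 ?sg_ge0.
  by have := sgZ (sg x)^-1 x; rewrite mulVf.
have KK : convex_cone K.
  split=> [x y Kx Ky i|c x c0 Kx i]; rewrite mxE; first exact: addr_ge0.
  exact: mulr_ge0.
have ps : sublinear_on K p.
  split=> [x y Kx Ky|c x c0 Kx]; last first.
    rewrite /p sgZ; move: c0; rewrite le_eqVlt => /predU1P[<-|c0].
      by rewrite !mul0r.
    by rewrite invfM scalerA [_ / _ * c]mulrAC mulVf ?gt_eqF// mul1r mulrA.
  have [x0|x0] := eqVneq (sg x) 0.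
    by rewrite (sg_eq0 _ Kx x0) add0r /p -(scale0r x) sgZ !mul0r add0r.
  have [y0|y0] := eqVneq (sg y) 0.
    by rewrite (sg_eq0 _ Ky y0) addr0 /p -(scale0r x) sgZ !mul0r addr0.
  have xp : 0 < sg x by rewrite lt_neqAle eq_sym x0 sg_ge0.
  have yp : 0 < sg y by rewrite lt_neqAle eq_sym y0 sg_ge0.
  have xyp : 0 < sg x + sg y by rewrite addr_gt0.
  (* Normalizing [x + y] gives the convex combination of the normalized [x] and [y] with weights
     proportional to [sg x] and [sg y]. *)
  have c01 : 0 <= sg x / (sg x + sg y) <= 1.
    rewrite divr_ge0 ?(ltW xp) ?(ltW xyp)//= ler_pdivrMr// mul1r.
    by rewrite lerDl ltW.
  have := Gconv c01 (Kbary _ Kx x0) (Kbary _ Ky y0).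
  have -> : 1 - sg x / (sg x + sg y) = sg y / (sg x + sg y).
    by field; rewrite gt_eqF.
  rewrite !scalerA ![_ / (_ + _) / _]mulrAC !divff// !mul1r -scalerDr -sgD.
  rewrite -(ler_pM2l xyp) -sgD -/(p _) => /le_trans; apply.
  rewrite le_eqVlt; apply/orP; left; apply/eqP; rewrite /p sgD.
  by field; rewrite gt_eqF.
have [l [lK lw]] : exists l : 'I_m -> R,
    (forall v, K v -> \sum_i l i * v 0 i <= p v) /\ \sum_i l i * w 0 i = p w.
  apply: hahn_banach_row => // v.
  (* With this [s], each [s * w 0 i] dominates the absolute value of [v 0 i]. *)
  exists (\sum_i `|v 0 i| / w 0 i).
    by apply: sumr_ge0 => i _; rewrite divr_ge0// ltW.
  move=> i; rewrite !mxE; set s := \sum_ _ _.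
  have : `|v 0 i| / w 0 i <= s.
    by rewrite /s (bigD1 i)//= lerDl sumr_ge0// => j _; rewrite divr_ge0// ltW.
  rewrite ler_pdivrMr// => h; have := ler_norm (- v 0 i); rewrite normrN; lra.
have pE b : barycentric b -> p b = G b.
  by move=> [_ b1]; rewrite /p /sg b1 invr1 scale1r mul1r.
exists l; split=> [b bD|]; last by rewrite lw pE.
by rewrite -pE//; apply: lK; case: bD.
Qed.

(** The point [z] prolongs the segment from [x] through [y] by the factor [e^-1]; the coordinatewise
    bound says exactly that its coordinates stay nonnegative. *)
Lemma barycentric_shrink (x y : 'rV[R]_m) (e : R) : 0 < e <= 1 ->
  barycentric x -> barycentric y -> (forall i, (1 - e) * x 0 i <= y 0 i) ->
  exists2 z, barycentric z & y = e *: z + (1 - e) *: x.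
Proof.
move=> /andP[e0 e1] [x0 x1] [y0 y1] xy.
exists (e^-1 *: (y - (1 - e) *: x)); last first.
  by rewrite scalerA mulfV ?gt_eqF// scale1r subrK.
split=> [i|].
  by rewrite !mxE mulr_ge0 ?invr_ge0 ?(ltW e0)// subr_ge0.
under eq_bigr do rewrite !mxE.
rewrite -mulr_sumr sumrB y1 -mulr_sumr x1 mulr1 opprB addrCA subrr addr0.
by rewrite mulVf ?gt_eqF.
Qed.

Lemma barycentric_le1 x i : @barycentric R m x -> x 0 i <= 1.
Proof.
by move=> [x0 <-]; rewrite (bigD1 i)//= lerDl; apply: sumr_ge0.
Qed.

Variable M : R.
Hypothesis GM : forall x, barycentric x -> G x <= M.

(** A quantitative upper semicontinuity: the bounds [(1 - e) * x 0 i <= y 0 i] describe a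
    neighborhood of [x] in the simplex, and the right-hand side tends to [G x] as [e] tends to 0. *)
Lemma barycentric_convex_le x y (e : R) : 0 < e <= 1 ->
  barycentric x -> barycentric y -> (forall i, (1 - e) * x 0 i <= y 0 i) ->
  G y <= e * M + (1 - e) * G x.
Proof.
move=> e01 xD yD xy; have [z zD ->] := barycentric_shrink e01 xD yD xy.
have e01' : 0 <= e <= 1 by case/andP: e01 => /ltW -> ->.
apply: le_trans (Gconv e01' zD xD) _.
by rewrite lerD2r ler_wpM2l ?GM//; case/andP: e01'.
Qed.

(* Reflect [x] through the center of the simplex. *)
Lemma barycentric_convex_bounded : exists N, forall x, barycentric x -> N <= G x.
Proof.
have [m0|m0] := posnP m.
  by exists 0 => x xD; have := barycentric_gt0 (ex_intro _ x xD); rewrite {1}m0.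
(* The value [1 / (m + 1)] is below every coordinate [1 / m] of the center [b], so
   [d * x 0 i <= b 0 i], and it is less than 1 even for [m = 1]. *)
pose d : R := m.+1%:R^-1; pose b : 'rV[R]_m := const_mx m%:R^-1.
have m0' : 0 < m%:R :> R by rewrite ltr0n.
have d0 : 0 < d by rewrite invr_gt0 ltr0n.
have d1 : d < 1 by rewrite invf_lt1 ?ltr0n// ltr1n.
have dm : d <= m%:R^-1 by rewrite lef_pV2 ?posrE ?ltr0n// ler_nat.
have bD : barycentric b.
  split=> [i|]; first by rewrite mxE invr_ge0 ltW.
  under eq_bigr do rewrite mxE.
  by rewrite sumr_const card_ord -[RHS](@mulVf _ m%:R) ?gt_eqF// mulr_natr.
have d01 : 0 < 1 - d <= 1 by rewrite subr_gt0 d1/= lerBlDr lerDl ltW.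
exists ((G b - (1 - d) * M) / d) => x xD.
rewrite ler_pdivrMr// lerBlDl.
have := barycentric_convex_le d01 xD bD; rewrite opprB addrCA subrr addr0.
rewrite (mulrC (G x)); apply => i.
rewrite mxE (le_trans _ dm)// -[leRHS]mulr1.
by rewrite ler_wpM2l ?(ltW d0)// barycentric_le1.
Qed.

End simplex_convex.

(** * Measurability *)

Section measurable_convex.
Context (R : realType) (n : nat).

Definition bary_row (t : measurable_Rn R n) : 'rV[R]_n.+1 := \row_i bary t i.

Lemma bary_widen (t : measurable_Rn R n) (i : 'I_n) :
  bary t (widen_ord (leqnSn n) i) = tnth t i.
Proof. by rewrite /bary (set_nth_default 0) ?size_tuple/= ?(tnth_nth 0). Qed.

Lemma bary_max (t : measurable_Rn R n) :
  bary t ord_max = 1 - \sum_(j < n) tnth t j.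
Proof. by rewrite /bary nth_default ?size_tuple. Qed.

Lemma sum_bary (t : measurable_Rn R n) : \sum_i bary t i = 1.
Proof.
rewrite big_ord_recr /= bary_max (eq_bigr (fun i : 'I_n => tnth t i)).
  by rewrite addrC subrK.
by move=> i _; exact: bary_widen.
Qed.

Lemma simplexP (t : measurable_Rn R n) :
  simplex R n t <-> forall i, 0 <= bary t i.
Proof.
split=> [[t0 t1] i|t0].
  have [ni|ni] := ltnP i n.
    rewrite (_ : i = widen_ord (leqnSn n) (Ordinal ni)) ?bary_widen//.
    exact: val_inj.
  rewrite (_ : i = ord_max) ?bary_max ?subr_ge0//; apply: val_inj => /=.
  by apply/eqP; rewrite eqn_leq ni -ltnS ltn_ord.
split=> [i|]; first by rewrite -bary_widen.
by have := t0 ord_max; rewrite bary_max subr_ge0.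
Qed.

Lemma bary_row_barycentric (t : measurable_Rn R n) :
  simplex R n t -> barycentric (bary_row t).
Proof.
move=> /simplexP t0; split=> [i|]; first by rewrite mxE.
by rewrite -[RHS](sum_bary t); apply: eq_bigr => i _; rewrite mxE.
Qed.

(* The sets [{t | forall i, q_i <= t_i}] with rational [q] form a countable
   base of neighborhoods for the upper semicontinuity of [G]. *)
Lemma measurable_barycentric_convex (G : 'rV[R]_n.+1 -> R) (M : R) :
  (forall (c : R) x y, 0 <= c <= 1 -> barycentric x -> barycentric y ->
    G (c *: x + (1 - c) *: y) <= c * G x + (1 - c) * G y) ->
  (forall x, barycentric x -> G x <= M) ->
  measurable_fun (simplex R n) (fun t => G (bary_row t)).
Proof.
move=> Gc GM mE; apply: (measurability _ (RGenInftyO.measurableE R)) => //.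
move=> _ [_ [c ->] <-].
set A := _ `&` _.
pose U (q : {ffun 'I_n.+1 -> rat}) : set (measurable_Rn R n) :=
  simplex R n `&` \bigcap_(i in [set: 'I_n.+1])
    (fun t : measurable_Rn R n => bary t i) @^-1` `[ratr (q i), +oo[%classic.
have mU q : measurable (U q).
  apply: measurableI => //; apply: fin_bigcap_measurable => // i _.
  by rewrite -[X in measurable X]setTI; exact: measurable_bary.
(* [A] is the part of the simplex where [G < c]. It is the union of the countably many [U q] that it
   contains; the other indices contribute the empty set. *)
rewrite (_ : A = \bigcup_q (if `[< U q `<=` A >] then U q else set0)); last first.
  apply/seteqP; split=> [t [tE]|t [q _]]; last first.
    by case: ifPn => // /asboolP; apply.
  rewrite /= in_itv/= => tc.
  have tD := bary_row_barycentric tE.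
  have [e /andP[e0 e1] eM] : exists2 e, 0 < e <= 1 &
      e * M + (1 - e) * G (bary_row t) < c.
    have := GM _ tD; move: tc; set u := G _ => uc uM.
    have d0 : 0 < c - u + (M - u) by lra.
    (* The requirement amounts to [e * (M - u) < c - u]; the denominator stays positive when
       [M = u]. *)
    pose e := (c - u) / (c - u + (M - u)) / 2.
    have e0 : 0 < e by rewrite divr_gt0// divr_gt0//; lra.
    have eE : e * (c - u + (M - u)) = (c - u) / 2.
      by rewrite /e; field; rewrite gt_eqF.
    exists e; last by have := mulr_gt0 e0 (_ : 0 < c - u); lra.
    by rewrite e0/= /e ler_pdivrMr// ler_pdivrMr//; lra.
  (* Where [t_i = 0] the interval has no interior and [q_i = 0] is chosen; elsewhere a rational lies
     strictly inside. *)
  have qP i : exists q : rat, (1 - e) * bary t i <= ratr q <= bary t i.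
    have t0 : 0 <= bary t i by have := tD.1 i; rewrite mxE.
    have [ti|ti] := eqVneq (bary t i) 0.
      by exists 0; rewrite ti mulr0 rmorph0 lexx.
    have tlt : (1 - e) * bary t i < bary t i.
      by rewrite gtr_pMl ?lt_neqAle 1?eq_sym ?ti//; lra.
    have [q] := rat_in_itvoo tlt; rewrite in_itv/= => /andP[/ltW q1 /ltW q2].
    by exists q; rewrite q1 q2.
  have [q qt] := choice qP; exists [ffun i => q i] => //.
  rewrite ifT; last first.
    apply/asboolP => s [sE sq]; split=> //=; rewrite in_itv/=.
    apply: le_lt_trans eM; apply: (barycentric_convex_le Gc GM) => //.
    - by rewrite e0.
    - exact: bary_row_barycentric.
    - move=> i; rewrite !mxE; have /andP[qi _] := qt i.
      by apply: le_trans qi _; have := sq i Logic.I; rewrite /= in_itv/= andbT ffunE.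
  split=> // i _; rewrite /= in_itv/= andbT ffunE.
  by have /andP[] := qt i.
apply: countable_bigcupT_measurable; first exact: countableP.
by move=> q; case: ifP.
Qed.
End measurable_convex.

(** * Integration against a density *)

Section density.
Local Open Scope ereal_scope.
Context d (T : measurableType d) (R : realType).
Variables (mu nu : {measure set T -> \bar R}) (D : set T) (g : T -> R).
Hypotheses (mD : measurable D) (mg : measurable_fun D g).
Hypothesis g0 : forall x, (0 <= g x)%R.
Hypothesis nuE : forall A, measurable A -> A `<=` D ->
  nu A = \int[mu]_(x in A) (g x)%:E.

Import HBNNSimple.

Let mg' : measurable_fun D (EFin \o g).
Proof. exact/measurable_EFinP. Qed.

Let integral_density_nnsfun (h : {nnsfun T >-> R}) :
  \int[nu]_(x in D) (h x)%:E = \int[mu]_(x in D) ((h x)%:E * (g x)%:E).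
Proof.
have mh r : measurable (h @^-1` [set r]).
  by rewrite -[X in measurable X]setTI; exact: measurable_funP.
have mi r : measurable_fun D (fun x => (r * \1_(h @^-1` [set r]) x)%:E).
  by apply/measurable_EFinP/measurable_funM => //; exact: measurable_funTS.
have hi0 r x : 0 <= (r * \1_(h @^-1` [set r]) x)%:E.
  exact: nnfun_muleindic_ge0.
under eq_integral do rewrite fimfunE -fsumEFin//.
have hgE x : (h x)%:E * (g x)%:E =
    \sum_(r \in range h) ((r * \1_(h @^-1` [set r]) x)%:E * (g x)%:E).
  by rewrite {1}fimfunE -fsumEFin// ge0_mule_fsuml.
under [RHS]eq_integral do rewrite hgE.
rewrite !ge0_integral_fsum//; last 2 first.
- by move=> r; exact: emeasurable_funM.
- by move=> r x _; rewrite mule_ge0// lee_fin.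
apply: eq_fsbigr => r /[!inE] -[t _ <-]; set A := h @^-1` _.
rewrite integralZl_indic_nnsfun// integral_indic//.
rewrite (nuE (measurableI _ _ (mh _) mD)); last by move=> ? [].
under [RHS]eq_integral do rewrite EFinM -muleA.
rewrite ge0_integralZl ?lee_fin//.
- congr (_ * _); rewrite integral_mkcondl.
  by apply: eq_integral => x _; rewrite epatch_indic muleC.
- apply: emeasurable_funM => //; apply/measurable_EFinP.
  by apply: measurable_indic; exact: mh.
- by move=> x _; rewrite mule_ge0// lee_fin.
Qed.

(** The identity holds for indicators by [nuE], for nonnegative simple functions by linearity, and
    passes to increasing limits by monotone convergence on both sides. *)
Lemma ge0_integral_density (h : T -> \bar R) :
  measurable_fun D h -> (forall x, D x -> 0 <= h x) ->
  \int[nu]_(x in D) h x = \int[mu]_(x in D) (h x * (g x)%:E).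
Proof.
move=> mh h0; pose h_ := nnsfun_approx mD mh.
have hE x : D x -> (h_ k x)%:E @[k --> \oo] --> h x.
  by move=> Dx; exact: cvg_nnsfun_approx.
have h_nd x a b : (a <= b)%N -> (h_ a x <= h_ b x)%R.
  by move=> ab; exact/lefP/nd_nnsfun_approx.
transitivity (limn (fun k => \int[nu]_(x in D) (h_ k x)%:E)).
  rewrite -monotone_convergence//.
  - by apply: eq_integral => x /[!inE] Dx; apply/esym/cvg_lim => //; exact: hE.
  - by move=> k; apply/measurable_EFinP/measurable_funTS.
  - by move=> k x _; rewrite lee_fin.
  - by move=> x _ a b ab; rewrite lee_fin h_nd.
transitivity (limn (fun k => \int[mu]_(x in D) ((h_ k x)%:E * (g x)%:E))).
  by congr (limn _); apply/funext => k; exact: integral_density_nnsfun.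
rewrite -monotone_convergence//.
- apply: eq_integral => x /[!inE] Dx; apply/cvg_lim => //.
  by apply: cvgeZr => //; exact: hE.
- move=> k; apply: emeasurable_funM => //.
  by apply/measurable_EFinP/measurable_funTS.
- by move=> k x _; rewrite mule_ge0// lee_fin.
- by move=> x _ a b ab; rewrite lee_wpmul2r ?lee_fin// h_nd.
Qed.

End density.

(** * Dirichlet integrals *)

Section power_convolution.
Context (R : realType).
Implicit Types (p s x : R) (m : nat).

(* Cutting off at 0 is needed because [x `^ p = 1] for [x < 0]. *)
Definition pos_powR p x : R := if 0 <= x then x `^ p else 0.

Lemma pos_powR_ge0 p x : 0 <= pos_powR p x.
Proof. by rewrite /pos_powR; case: ifP => // _; exact: powR_ge0. Qed.

Lemma measurable_pos_powR p : measurable_fun setT (pos_powR p).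
Proof.
by apply: measurable_fun_ifT => //; exact: measurable_fun_ler.
Qed.

(** The exponent -1 is excluded because of [x = 0], where the zeroth power is 1. *)
Lemma pos_powRS p x : p != -1 -> pos_powR (p + 1) x = x * pos_powR p x.
Proof.
move=> p1; have p10 : p + 1 != 0 by rewrite addr_eq0.
rewrite /pos_powR; case: ifPn => [x0|_]; last by rewrite mulr0.
have [->|xn0] := eqVneq x 0; first by rewrite powR0// mul0r.
by rewrite powRD ?xn0 ?implybT// powRr1// mulrC.
Qed.

Local Open Scope ereal_scope.

(** The convolution of two truncated powers: an Euler Beta integral up to a power of [s]. *)
Definition pow_conv (a b s : R) : \bar R :=
  \int[@lebesgue_measure R]_x (pos_powR a x * pos_powR b (s - x))%:E.

Lemma measurable_pow_conv (a b s : R) :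
  measurable_fun setT (fun x => pos_powR a x * pos_powR b (s - x))%R.
Proof.
apply: measurable_funM; first exact: measurable_pos_powR.
apply: (measurableT_comp (measurable_pos_powR b)).
exact: measurable_funB.
Qed.

Lemma pow_convC (a b s : R) : pow_conv a b s = pow_conv b a s.
Proof.
pose f (x : measurableTypeR R) : measurableTypeR R := (s - x)%R.
have mf : measurable_fun setT f by exact: measurable_funB.
(* Reflection preserves Lebesgue measure, since the preimage of a half-open interval is a half-open
   interval of the same length. *)
have fE A : measurable A ->
    pushforward (@lebesgue_measure R) f A = @lebesgue_measure R A.
  move=> mA; apply/esym/lebesgue_measure_unique => //= _ [[u v]] _ <-.
  rewrite /pushforward (_ : f @^-1` _ = `[(s - v)%R, (s - u)%R[%classic).
    rewrite !lebesgue_measure_itv/= !lte_fin ltrD2l ltrN2.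
    by case: ifP => // _; rewrite -!EFinB; congr EFin; ring.
  rewrite /f; apply/seteqP.
  by split=> x /=; rewrite !in_itv/= => /andP[? ?]; apply/andP; split; lra.
rewrite /pow_conv -(@eq_measure_integral _ _ _ setT _
  (pushforward (@lebesgue_measure R) f)); last first.
  by move=> A mA _; exact: fE.
rewrite ge0_integral_pushforward//=.
- by apply: eq_integral => x _; rewrite /f/= subKr mulrC.
- apply/measurable_EFinP; exact: measurable_pow_conv.
- by move=> x _; rewrite lee_fin mulr_ge0 ?pos_powR_ge0.
Qed.

(** For [p < 0] the integrand is unbounded near 0, so the fundamental theorem of calculus is used on
    [[s / (k + 1), s]], and monotone convergence lets [k] tend to infinity. *)
Lemma integral_powR p s : (-1 < p)%R -> (0 < s)%R ->
  \int[@lebesgue_measure R]_(x in `[0%R, s]) (x `^ p)%:E =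
  (s `^ (p + 1) / (p + 1))%:E.
Proof.
move=> p1 s0.
have q0 : (0 < p + 1)%R by lra.
have mp D : measurable_fun D (fun x : R => (x `^ p)%:E).
  by apply/measurable_EFinP; apply: measurable_funTS; exact: measurable_powR.
rewrite -integral_itv_obnd_cbnd//.
pose e k : R := (s / k.+1%:R)%R.
have e0 k : (0 < e k)%R by rewrite divr_gt0.
pose I k : set R := `[e k, s]%classic.
have UI : `]0%R, s]%classic = \bigcup_k I k.
  apply/seteqP; split=> x /=; rewrite ?in_itv/=; last first.
    by move=> [k _]; rewrite /I /= in_itv/= => /andP[ek ->]; rewrite (lt_le_trans _ ek).
  move=> /andP[x0 xs]; have [k kx] := ltr_add_invr (divr_gt0 x0 s0).
  exists k => //; rewrite /I /= in_itv/= xs andbT.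
  move: kx; rewrite add0r ltr_pdivlMr// mulrC => /ltW; exact.
have cvI : \int[@lebesgue_measure R]_(x in I k) (x `^ p)%:E @[k --> \oo] -->
    \int[@lebesgue_measure R]_(x in `]0%R, s]) (x `^ p)%:E.
  rewrite UI; apply: ge0_nondecreasing_set_cvg_integral => //.
  - move=> a b ab; apply/subsetPset => x; rewrite /I /= !in_itv/= => /andP[h ->].
    rewrite andbT (le_trans _ h)// ler_pM2l// lef_pV2 ?posrE// ler_nat.
    by rewrite ltnS.
  - by move=> k; exact: measurable_itv.
  - by move=> k; exact: mp.
  - by move=> k x _; rewrite lee_fin powR_ge0.
(* For [k = 0] the interval degenerates, as [e 0 = s]. *)
have IE k : (0 < k)%N -> \int[@lebesgue_measure R]_(x in I k) (x `^ p)%:E =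
    ((s `^ (p + 1) - e k `^ (p + 1)) / (p + 1))%:E.
  move=> k0; have eks : (e k < s)%R.
    by rewrite /e ltr_pdivrMr// -[ltLHS]mulr1 ltr_pM2l// ltr1n.
  have cpow a (x : R) : (0 < x)%R -> {for x, continuous (fun x : R => x `^ a)%R}.
    move=> x0; apply/differentiable_continuous/derivable1_diffP.
    by apply: derivable_powR; rewrite in_itv/= x0.
  rewrite (@continuous_FTC2 R _ (fun x => x `^ (p + 1) / (p + 1))%R (e k) s)//.
  - by rewrite -EFinB mulrBl.
  - apply: continuous_in_subspaceT => x; rewrite inE/= in_itv/= => /andP[h _].
    by apply: cpow; exact: lt_le_trans h.
  - split.
    + move=> x; rewrite in_itv/= => /andP[h _]; apply: derivableM => //.
      by apply: derivable_powR; rewrite in_itv/= (lt_trans _ h).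
    + apply: cvg_at_right_filter; apply: cvgM; last exact: cvg_cst.
      exact: cpow.
    + apply: cvg_at_left_filter; apply: cvgM; last exact: cvg_cst.
      exact: cpow.
  - move=> x; rewrite in_itv/= => /andP[h _].
    have x0 : (0 < x)%R by rewrite (lt_trans _ h).
    have dx : derivable (fun x : R => x `^ (p + 1))%R x 1.
      by apply: derivable_powR; rewrite in_itv/= x0.
    rewrite derive1E deriveM// derive_cst scaler0 add0r -derive1E.
    rewrite powR_derive1 ?in_itv/= ?x0// addrK.
    by rewrite /GRing.scale/= mulrA mulVf ?mul1r// gt_eqF.
have e_cvg : e k @[k --> \oo] --> 0%R.
  rewrite -(mulr0 s); apply: cvgM; first exact: cvg_cst.
  exact: cvg_harmonic.
have cvE : \int[@lebesgue_measure R]_(x in I k) (x `^ p)%:E @[k --> \oo] -->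
    (s `^ (p + 1) / (p + 1))%:E.
  apply: (@cvg_trans _
    (((s `^ (p + 1) - e k `^ (p + 1)) / (p + 1))%:E @[k --> \oo])).
    by apply: near_eq_cvg; near=> k; rewrite IE//; near: k; exact: nbhs_infty_gt.
  apply: cvg_EFin; first by near=> k.
  have -> : (s `^ (p + 1) / (p + 1) = (s `^ (p + 1) - 0) / (p + 1))%R by rewrite subr0.
  apply: cvgM; last exact: cvg_cst.
  apply: cvgB; first exact: cvg_cst.
  have := powR_cvg0 q0; move/cvg_at_rightP; apply; split=> //.
exact: cvg_unique cvI cvE.
Unshelve. all: by end_near. Qed.

(** [pos_powR 0] is the indicator of the nonnegative reals, 0 included, so it cuts the integral off
    at [s]. *)
Lemma pow_conv0 p s : (-1 < p)%R ->
  pow_conv p 0 s = (pos_powR (p + 1) s / (p + 1))%:E.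
Proof.
move=> p1; rewrite /pow_conv.
transitivity (\int[@lebesgue_measure R]_(x in `[0%R, s]) (x `^ p)%:E).
  rewrite [RHS]integral_mkcond; apply: eq_integral => x _.
  rewrite patchE mem_setE in_itv/= /pos_powR subr_ge0 powRr0.
  by case: (leP 0%R x) => _; case: (leP x s) => _ /=; rewrite ?mulr1 ?mulr0 ?mul0r.
rewrite /pos_powR; case: ltgtP => s0.
- by rewrite integral_powR.
- by rewrite set_itv_ge ?integral_set0 ?mul0r// bnd_simp -ltNge.
- by rewrite -s0 set_itv1 integral_set1 powR0 ?mul0r// gt_eqF//; lra.
Qed.

Lemma rising_factorialSr p m :
  rising_factorial p m.+1 = (rising_factorial p m * (p + m%:R))%R.
Proof. by rewrite /rising_factorial big_ord_recr. Qed.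

Lemma rising_factorialSl p m :
  rising_factorial p m.+1 = (p * rising_factorial (p + 1) m)%R.
Proof.
rewrite /rising_factorial big_ord_recl addr0; congr (_ * _)%R.
by apply: eq_bigr => i _ /=; rewrite /bump/= natrD addrA.
Qed.

Lemma rising_factorialD p m k : rising_factorial p (m + k) =
  (rising_factorial p m * rising_factorial (p + m%:R) k)%R.
Proof.
rewrite /rising_factorial big_split_ord/=; congr (_ * _)%R.
by apply: eq_bigr => i _; rewrite natrD addrA.
Qed.

Lemma rising_factorial_gt0 p m : (0 < p)%R -> (0 < rising_factorial p m)%R.
Proof. by move=> p0; apply: prodr_gt0 => i _; rewrite ltr_wpDr. Qed.

(* [(s - x)^(m+1) = s (s - x)^m - x (s - x)^m] replaces integration by parts. *)
Lemma pow_convn p m s : (-1 < p)%R ->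
  pow_conv p m%:R s =
  (m`!%:R / rising_factorial (p + 1) m.+1 * pos_powR (p + m.+1%:R) s)%:E.
Proof.
elim: m p => [|m IH] p p1.
  rewrite pow_conv0// /rising_factorial big_ord1 addr0.
  by congr EFin; rewrite fact0 mul1r mulrC.
have p2 : (-1 < p + 1)%R by lra.
have q0 : (0 < p + 1)%R by lra.
(* Stated as a sum, this involves only nonnegative integrands; the second integral is finite by
   induction, which permits the subtraction afterwards. *)
have key : pow_conv p m.+1%:R s + pow_conv (p + 1) m%:R s = s%:E * pow_conv p m%:R s.
  (* For [s < 0] the two factors have disjoint supports, so all three integrals vanish; for [0 <= s]
     the constant can enter the integral. *)
  have [s0|s0] := leP 0%R s; last first.
    have z a b : pow_conv a b s = 0.
      apply: integral0_eq => x _; rewrite /pos_powR subr_ge0.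
      case: (leP 0%R x) => x0; last by rewrite mul0r.
      by rewrite leNgt (lt_le_trans s0 x0) mulr0.
    by rewrite !z mule0 adde0.
  rewrite /pow_conv -ge0_integralZl//; last 2 first.
    - by apply/measurable_EFinP; exact: measurable_pow_conv.
    - by move=> x _; rewrite lee_fin mulr_ge0 ?pos_powR_ge0.
  rewrite -ge0_integralD//; last 4 first.
    - by move=> x _; rewrite lee_fin mulr_ge0 ?pos_powR_ge0.
    - by apply/measurable_EFinP; exact: measurable_pow_conv.
    - by move=> x _; rewrite lee_fin mulr_ge0 ?pos_powR_ge0.
    - by apply/measurable_EFinP; exact: measurable_pow_conv.
  apply: eq_integral => x _; rewrite -EFinD -EFinM; congr EFin.
  have pN1 : p != (-1)%R by rewrite gt_eqF.
  have mN1 : m%:R != (-1)%R :> R by rewrite gt_eqF// (lt_le_trans (ltrN10 R)).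
  by rewrite -natr1 !pos_powRS//; ring.
rewrite (IH _ p2) (IH _ p1) in key.
have -> : pow_conv p m.+1%:R s =
    s%:E * (m`!%:R / rising_factorial (p + 1) m.+1 * pos_powR (p + m.+1%:R) s)%:E
    - (m`!%:R / rising_factorial (p + 1 + 1) m.+1 *
       pos_powR (p + 1 + m.+1%:R) s)%:E by rewrite -key addeK.
rewrite -EFinM -EFinB; congr EFin.
rewrite [(p + m.+2%:R)%R](_ : _ = p + m.+1%:R + 1)%R; last by rewrite -natr1 addrA.
rewrite [(p + 1 + m.+1%:R)%R](_ : _ = p + m.+1%:R + 1)%R; last by ring.
rewrite pos_powRS; last by rewrite gt_eqF// ltr_wpDr.
have r0 := @rising_factorial_gt0 (p + 1 + 1) m (ltac:(lra)).
rewrite (rising_factorialSl (p + 1) m.+1) (rising_factorialSl (p + 1) m).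
rewrite (rising_factorialSr (p + 1 + 1) m) factS natrM -natr1.
have m0 : (0 <= m%:R :> R)%R by [].
by field; rewrite !gt_eqF//; lra.
Qed.

End power_convolution.

Section dirichlet.
Context (R : realType).

(** Coordinates on the simplex of size [s], equal to [bary] for [s = 1]. Fixing the first coordinate
    [x] leaves a simplex of size [s - x], so an induction on [n] needs the size to vary. *)
Definition scaled_bary n (s : R) (t : measurable_Rn R n) (i : 'I_n.+1) : R :=
  nth (s - \sum_(j < n) tnth t j) t i.

Lemma measurable_scaled_bary n (s : R) (i : 'I_n.+1) :
  measurable_fun setT (fun t : measurable_Rn R n => scaled_bary s t i).
Proof.
have [ni|ni] := ltnP i n.
  rewrite (_ : (fun _ => _) = fun t : measurable_Rn R n => tnth t (Ordinal ni)).
    exact: measurable_tnth.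
  apply/funext => t; rewrite /scaled_bary.
  by rewrite (set_nth_default 0) ?size_tuple ?(tnth_nth 0).
rewrite (_ : (fun _ => _) =
  fun t : measurable_Rn R n => s - \sum_(j < n) tnth t j); last first.
  by apply/funext => t; rewrite /scaled_bary nth_default ?size_tuple.
apply: measurable_funB => //.
by apply: measurable_sum => j; exact: measurable_tnth.
Qed.

Lemma scaled_bary_cons0 n (s x : R) (t : measurable_Rn R n) :
  scaled_bary s (tuple_cons (x, t)) ord0 = x.
Proof. by []. Qed.

Lemma scaled_bary_consS n (s x : R) (t : measurable_Rn R n) i :
  scaled_bary s (tuple_cons (x, t)) (lift ord0 i) = scaled_bary (s - x) t i.
Proof.
rewrite /scaled_bary /= big_ord_recl /= tnth0 opprD addrA; congr (nth (_ - _) _ _).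
by apply: eq_bigr => j _; rewrite tnthS.
Qed.

Local Open Scope ereal_scope.

Lemma ge0_integral_lebesgue_RnS n (F : measurable_Rn R n.+1 -> \bar R) :
  measurable_fun setT F -> (forall t, 0 <= F t) ->
  \int[lebesgue_Rn R n.+1]_t F t =
  \int[@lebesgue_measure R]_x \int[lebesgue_Rn R n]_t F (tuple_cons (x, t)).
Proof.
move=> mF F0.
have mc := @measurable_tuple_cons R n.
transitivity (\int[@lebesgue_measure R \x lebesgue_Rn R n]_z F (tuple_cons z)).
  transitivity (\int[pushforward (@lebesgue_measure R \x lebesgue_Rn R n)
    (@tuple_cons R n)]_z F z).
    exact: eq_measure_integral.
  by rewrite ge0_integral_pushforward.
rewrite fubini_tonelli1//; exact: measurableT_comp.
Qed.

Definition dirichlet_exponent n (i0 : 'I_n) (p : R) (k : 'I_n -> nat) i : R :=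
  if i == i0 then p else (k i)%:R.

Lemma measurable_dirichlet n (s : R) (e : 'I_n.+1 -> R) :
  measurable_fun setT (fun t : measurable_Rn R n =>
    \prod_i pos_powR (e i) (scaled_bary s t i))%R.
Proof.
apply: measurable_prod => i _.
apply: (measurableT_comp (measurable_pos_powR _)).
exact: measurable_scaled_bary.
Qed.

Lemma fact_rising_factorial (a b : nat) :
  ((a + b)`!%:R = a`!%:R * rising_factorial (a%:R + 1 : R) b)%R.
Proof.
elim: b => [|b IH]; first by rewrite addn0 /rising_factorial big_ord0 mulr1.
rewrite addnS factS natrM IH rising_factorialSr -natr1 natrD; ring.
Qed.

(** Dirichlet's formula, by integrating over the first coordinate last. With a single real exponent
    the Gamma quotients are factorials and rising factorials, and every convolution that arises has
    a natural exponent, as [pow_convn] requires. *)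
Lemma dirichlet_integral n (i0 : 'I_n.+1) (p s : R) (k : 'I_n.+1 -> nat) :
  (-1 < p)%R ->
  let N := (\sum_(i | i != i0) (k i).+1)%N in
  \int[lebesgue_Rn R n]_t
    (\prod_i pos_powR (dirichlet_exponent i0 p k i) (scaled_bary s t i))%:E =
  ((\prod_(i | i != i0) (k i)`!%:R) / rising_factorial (p + 1) N *
   pos_powR (p + N%:R) s)%:E.
Proof.
elim: n i0 p s k => [|n IH] i0 p s k p1 N.
  rewrite integral_dirac//; last first.
    by apply/measurable_EFinP; exact: measurable_dirichlet.
  rewrite diracT mul1e big_ord1 /dirichlet_exponent (ord1 i0) eqxx.
  rewrite /scaled_bary /= big_ord0 subr0 /N (ord1 i0).
  rewrite !big_pred0 => [|i|i]; try by rewrite (ord1 i).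
  by rewrite /rising_factorial big_ord0 invr1 !mul1r addr0.
rewrite ge0_integral_lebesgue_RnS; last 2 first.
- by apply/measurable_EFinP; exact: measurable_dirichlet.
- by move=> t; rewrite lee_fin prodr_ge0// => i _; exact: pos_powR_ge0.
set e := dirichlet_exponent i0 p k.
have inner x : \int[lebesgue_Rn R n]_t
      (\prod_i pos_powR (e i) (scaled_bary s (tuple_cons (x, t)) i))%:E =
    (pos_powR (e ord0) x)%:E * \int[lebesgue_Rn R n]_t
      (\prod_i pos_powR (e (lift ord0 i)) (scaled_bary (s - x) t i))%:E.
  rewrite -ge0_integralZl ?lee_fin ?pos_powR_ge0//; last 2 first.
  - by apply/measurable_EFinP; exact: measurable_dirichlet.
  - by move=> t _; rewrite lee_fin prodr_ge0// => i _; exact: pos_powR_ge0.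
  apply: eq_integral => t _; rewrite big_ord_recl scaled_bary_cons0 -EFinM.
  congr (_ * _)%:E; apply: eq_bigr => i _.
  by rewrite scaled_bary_consS.
under eq_integral do rewrite inner.
have outer a b c : (0 <= c)%R ->
    \int[@lebesgue_measure R]_x
      ((pos_powR a x)%:E * (c * pos_powR b (s - x))%:E) = c%:E * pow_conv a b s.
  move=> c0; rewrite -ge0_integralZl//.
  - by apply: eq_integral => x _; rewrite -!EFinM mulrCA.
  - by apply/measurable_EFinP; exact: measurable_pow_conv.
  - by move=> x _; rewrite lee_fin mulr_ge0 ?pos_powR_ge0.
have prod_ge0 (P : pred 'I_n.+1) :
    (0 <= \prod_(i | P i) (k (lift ord0 i))`!%:R :> R)%R.
  by apply: prodr_ge0.
have [j i0E|i0E] := unliftP ord0 i0.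
(* The real exponent sits in the inner integral; the outer convolution has exponents [k ord0] and
   [p + N']. *)
- pose N' := (\sum_(i | i != j) (k (lift ord0 i)).+1)%N.
  have NE : N = ((k ord0).+1 + N')%N.
    rewrite /N big_mkcond big_ord_recl i0E /= -big_mkcond /=.
    by congr (_ + _)%N; apply: eq_bigl => i; rewrite (inj_eq lift_inj).
  have PE : (\prod_(i | i != i0) (k i)`!%:R =
      (k ord0)`!%:R * \prod_(i | i != j) (k (lift ord0 i))`!%:R :> R)%R.
    rewrite big_mkcond big_ord_recl i0E /= -big_mkcond /=.
    by congr (_ * _)%R; apply: eq_bigl => i; rewrite (inj_eq lift_inj).
  have e0 : e ord0 = (k ord0)%:R by rewrite /e /dirichlet_exponent i0E.
  have eS i : e (lift ord0 i) = dirichlet_exponent j p (k \o lift ord0) i.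
    by rewrite /e /dirichlet_exponent i0E (inj_eq lift_inj).
  under eq_integral => x _.
    under eq_integral do under eq_bigr do rewrite eS.
    rewrite (IH j p (s - x)%R (k \o lift ord0) p1) e0 -/N'.
    over.
  have pN : (-1 < p + N'%:R)%R by rewrite ltr_wpDr.
  have r0 : (0 < rising_factorial (p + 1) N')%R.
    by apply: rising_factorial_gt0; lra.
  rewrite outer; last exact: (divr_ge0 (prod_ge0 _) (ltW r0)).
  rewrite pow_convC pow_convn// -EFinM; congr EFin.
  rewrite NE PE addnC natrD addrA rising_factorialD.
  rewrite (_ : p + N'%:R + 1 = p + 1 + N'%:R)%R; last by rewrite addrAC.
  have r1 : (0 < rising_factorial (p + 1 + N'%:R) (k ord0).+1)%R.
    by apply: rising_factorial_gt0; rewrite ltr_wpDr//; lra.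
  rewrite mulrA; congr (_ * _)%R; field.
  by rewrite !gt_eqF.
(* The real exponent belongs to the outer variable. The inner exponents are all natural, and the
   induction hypothesis takes the first of them, [l], as its real one. *)
- pose N' := (\sum_(i < n.+1 | i != ord0) (k (lift ord0 i)).+1)%N.
  pose l := k (lift ord0 ord0).
  have NE : N = (l + N').+1.
    by rewrite /N big_mkcond big_ord_recl i0E /= add0n (bigD1 ord0).
  have PE : (\prod_(i | i != i0) (k i)`!%:R =
      l`!%:R * \prod_(i < n.+1 | i != ord0) (k (lift ord0 i))`!%:R :> R)%R.
    by rewrite big_mkcond big_ord_recl i0E /= mul1r (bigD1 ord0).
  have e0 : e ord0 = p by rewrite /e /dirichlet_exponent i0E eqxx.
  have eS i : e (lift ord0 i) = dirichlet_exponent ord0 l%:R (k \o lift ord0) i.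
    by rewrite /e /dirichlet_exponent i0E /=; case: eqP => // ->.
  have l1 : (-1 < l%:R :> R)%R by rewrite (lt_le_trans (ltrN10 R)).
  under eq_integral => x _.
    under eq_integral do under eq_bigr do rewrite eS.
    rewrite (IH ord0 l%:R (s - x)%R (k \o lift ord0) l1) e0 -/N' -natrD.
    over.
  have r0 : (0 < rising_factorial (l%:R + 1 : R) N')%R.
    by apply: rising_factorial_gt0; rewrite ltr_wpDl.
  rewrite outer; last exact: (divr_ge0 (prod_ge0 _) (ltW r0)).
  rewrite pow_convn// -EFinM; congr EFin.
  rewrite NE PE fact_rising_factorial.
  have r1 : (0 < rising_factorial (p + 1) (l + N').+1)%R.
    by apply: rising_factorial_gt0; lra.
  rewrite mulrA; congr (_ * _)%R; field.
  by rewrite !gt_eqF.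
Qed.

End dirichlet.

(** * The measure and its barycenter *)

Section simplex_moments.
Context (R : realType) (n : nat).
Local Notation mu := (lebesgue_Rn R n).

(** The cutoffs in [pos_powR] carry the indicator of the simplex: outside it some coordinate is
    negative and its factor is 0. *)
Lemma integral_simplex_dirichlet (e : 'I_n.+1 -> R) :
  (\int[mu]_(t in simplex R n) (\prod_i bary t i `^ e i)%R%:E =
   \int[mu]_t (\prod_i pos_powR (e i) (scaled_bary 1 t i))%R%:E)%E.
Proof.
rewrite integral_mkcond; apply: eq_integral => t _; rewrite patchE.
have [tE|tE] := pselect (simplex R n t).
  rewrite mem_set//; congr EFin; apply: eq_bigr => i _.
  by rewrite /pos_powR ifT//; exact: (simplexP t).1.
rewrite memNset//; have /existsNP[i /negP ti] := contra_not (simplexP t).2 tE.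
by congr EFin; rewrite (bigD1 i)//= /pos_powR ifN ?mul0r.
Qed.

Lemma integral_simplex_powR (i : 'I_n.+1) (p : R) : -1 < p ->
  (\int[mu]_(t in simplex R n) (bary t i `^ p)%R%:E =
   (rising_factorial (p + 1) n)^-1%:E)%E.
Proof.
move=> p1; have := @dirichlet_integral R n i p 1 (fun=> 0%N) p1.
rewrite -integral_simplex_dirichlet /=.
rewrite sum_nat_const muln1 cardC1 card_ord /= [\prod_(_ < _ | _) _]big1//.
rewrite mul1r /pos_powR ler01 powR1 mulr1 => <-.
apply: eq_integral => t _; rewrite (bigD1 i)//= big1 ?mulr1.
  by rewrite /dirichlet_exponent eqxx.
by move=> l /negbTE li; rewrite /dirichlet_exponent li powRr0.
Qed.

Lemma integral_simplex_powR_bary (i j : 'I_n.+1) (p : R) : -1 < p ->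
  (\int[mu]_(t in simplex R n) (bary t i `^ p * bary t j)%R%:E =
   ((if i == j then p + 1 else 1) / rising_factorial (p + 1) n.+1)%:E)%E.
Proof.
move=> p1; have p0 : 0 < p + 1 by lra.
have [<-|ij] := eqVneq.
  have p2 : -1 < p + 1 by lra.
  transitivity (\int[mu]_(t in simplex R n) (bary t i `^ (p + 1))%R%:E)%E.
    apply: eq_integral => t /[!inE] /simplexP t0; congr EFin.
    (* Since [p] may be negative, exponents are added only at a nonzero base; at 0 both sides
       vanish. *)
    have [->|ti] := eqVneq (bary t i) 0; first by rewrite mulr0 powR0// gt_eqF.
    by rewrite powRD ?ti ?implybT// powRr1.
  rewrite integral_simplex_powR// rising_factorialSl; congr EFin.
  by rewrite invfM mulrA mulfV ?mul1r// gt_eqF.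
(* The natural exponents are 1 at [j] and 0 elsewhere, so the rising factorial has length
   [(n - 1) + 2]. *)
have := @dirichlet_integral R n i p 1 (fun l => nat_of_bool (l == j)) p1.
rewrite -integral_simplex_dirichlet /=.
have -> : (\sum_(l < n.+1 | l != i) (l == j).+1 = n.+1)%N.
  rewrite (eq_bigr (fun l => 1 + (l == j))%N)// big_split /=.
  rewrite sum_nat_const muln1 cardC1 card_ord /= (bigD1 j) 1?eq_sym//= eqxx.
  by rewrite big1 ?addn0 ?addn1// => l /andP[_ /negbTE->].
rewrite [\prod_(_ < _ | _) _]big1 => [|l _]; last by case: (l == j).
rewrite /pos_powR ler01 powR1 mulr1 => <-.
apply: eq_integral => t /[!inE] /simplexP t0; rewrite (bigD1 i)//= (bigD1 j) 1?eq_sym//=.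
rewrite big1 ?mulr1.
  by rewrite /dirichlet_exponent eqxx eq_sym (negbTE ij) eqxx powRr1.
by move=> l /andP[/negbTE li /negbTE lj]; rewrite /dirichlet_exponent li lj powRr0.
Qed.

Context (lam : measurable_Rn R n) (hn : (1 <= n)%N) (hlam : simplex_interior lam).

Lemma simplex_exponentP i : -1 < simplex_exponent lam i /\
  rising_factorial (simplex_exponent lam i + 1) n =
  n`!%:R * bary lam i / bary lam (ordS i).
Proof.
have [||e0 eE] := @inv_rising_factorialP R (n`!%:R * bary lam i / bary lam (ordS i)) n.
- by rewrite divr_gt0 ?mulr_gt0 ?ltr0n ?fact_gt0 ?bary_gt0.
- by [].
by rewrite /simplex_exponent subrK; split => //; lra.
Qed.

(** Each summand of the density has a single real exponent, so moments of the measure reduce to the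
    integrals above. *)
Lemma integral_simplex_density (phi : measurable_Rn R n -> R) (v : 'I_n.+1 -> R) :
  measurable_fun setT phi -> (forall t, simplex R n t -> 0 <= phi t) ->
  (forall i, \int[mu]_(t in simplex R n)
    (bary t i `^ simplex_exponent lam i * phi t)%R%:E = (v i)%:E)%E ->
  (\int[mu]_(t in simplex R n) (phi t * simplex_density lam t)%R%:E =
   (n`!%:R * \sum_i bary lam i * v i)%R%:E)%E.
Proof.
move=> mphi phi0 vE.
have mE := @measurable_simplex R n.
have mb i : measurable_fun (simplex R n)
    (fun t => (bary t i `^ simplex_exponent lam i * phi t)%:E).
  apply/measurable_EFinP; apply: measurable_funTS; apply: measurable_funM => //.
  by apply: (measurableT_comp (measurable_powR _)); exact: measurable_bary.
have b0 i t : simplex R n t -> (0 <= (bary t i `^ simplex_exponent lam i * phi t)%:E)%E.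
  by move=> tE; rewrite lee_fin mulr_ge0 ?powR_ge0 ?phi0.
have lam0 i : 0 <= bary lam i by exact/ltW/bary_gt0.
transitivity (\int[mu]_(t in simplex R n) (\sum_i
    (n`!%:R * bary lam i)%:E * (bary t i `^ simplex_exponent lam i * phi t)%:E))%E.
  apply: eq_integral => t _; rewrite sumEFin; congr EFin.
  rewrite /simplex_density mulrCA mulr_sumr mulr_sumr.
  by apply: eq_bigr => i _; ring.
rewrite ge0_integral_sum//; last 2 first.
- by move=> i; apply: emeasurable_funM.
- by move=> i t tE; rewrite mule_ge0 ?b0// lee_fin mulr_ge0.
rewrite mulr_sumr -sumEFin; apply: eq_bigr => i _.
rewrite ge0_integralZl ?vE// ?lee_fin ?mulr_ge0//.
- by rewrite -EFinM mulrA.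
- exact: b0.
Qed.

Local Notation nu := (simplex_measure hlam).

Lemma simplex_measure_simplex : nu (simplex R n) = 1%E.
Proof.
rewrite /simplex_measure setIid.
transitivity (\int[mu]_(t in simplex R n) (1 * simplex_density lam t)%R%:E)%E.
  by apply: eq_integral => t _; rewrite mul1r.
rewrite (@integral_simplex_density (fun=> 1)
  (fun i => (rising_factorial (simplex_exponent lam i + 1) n)^-1))//; last first.
  move=> i; under eq_integral do rewrite mulr1.
  by rewrite integral_simplex_powR//; case: (simplex_exponentP i).
(* Summand [i] equals [bary lam (ordS i)], and [ordS] permutes the indices. *)
congr EFin; rewrite -[RHS](sum_bary lam) [RHS](reindex_inj (@ordS_inj _)) mulr_sumr/=.
apply: eq_bigr => i _; have [_ ->] := simplex_exponentP i.
have f0 : n`!%:R != 0 :> R by rewrite pnatr_eq0 -lt0n fact_gt0.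
by field; rewrite f0 !gt_eqF// bary_gt0.
Qed.

Lemma simplex_measure_bary j :
  (\int[nu]_(t in simplex R n) (bary t j)%:E = (simplex_weight lam j)%:E)%E.
Proof.
have mE := @measurable_simplex R n.
rewrite (@ge0_integral_density _ _ _ mu _ _ (simplex_density lam))//; last 5 first.
- by apply: measurable_funTS; exact: measurable_simplex_density.
- by move=> t; exact: simplex_density_ge0.
- by move=> A mA AE; rewrite -[in RHS](setIidl AE).
- by apply/measurable_EFinP; apply: measurable_funTS; exact: measurable_bary.
- by move=> t /simplexP t0; rewrite lee_fin.
under eq_integral do rewrite -EFinM.
rewrite (@integral_simplex_density (fun t => bary t j)
  (fun i => (if i == j then simplex_exponent lam i + 1 else 1) /
            rising_factorial (simplex_exponent lam i + 1) n.+1))//; last 3 first.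
- exact: measurable_bary.
- by move=> t /simplexP.
- by move=> i; apply: integral_simplex_powR_bary; case: (simplex_exponentP i).
(* The rising factorial of length [n + 1] splits off its last factor; the remaining one of length
   [n] is prescribed by the choice of the exponent and cancels. *)
have key i c : n`!%:R * (bary lam i * (c /
      rising_factorial (simplex_exponent lam i + 1) n.+1)) =
    bary lam (ordS i) * (c / (simplex_exponent lam i + n%:R + 1)).
  have [e1 eE] := simplex_exponentP i; rewrite rising_factorialSr eE.
  have en : simplex_exponent lam i + n%:R + 1 != 0.
    by rewrite gt_eqF// addrAC ltr_wpDr//; lra.
  have f0 : n`!%:R != 0 :> R by rewrite pnatr_eq0 -lt0n fact_gt0.
  by field; rewrite en f0 !gt_eqF ?bary_gt0.
congr EFin; rewrite /simplex_weight mulr_sumr (bigD1 j)//= addrC eqxx key.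
by congr (_ + _); apply: eq_bigr => i /negbTE ->; rewrite key div1r.
Qed.

End simplex_moments.

(** * The two inequalities *)

Section jensen_simplex.
Context (R : realType) (n : nat) (lam : measurable_Rn R n).
Hypotheses (hn : (1 <= n)%N) (hlam : simplex_interior lam).
Local Notation nu := (simplex_measure hlam).
Local Notation w := (simplex_weight lam).

(** Places the barycenter in the interior, as [barycentric_subgradient] demands; the last summand is
    positive because the exponent exceeds -1. *)
Lemma simplex_weight_gt0 i : 0 < w i.
Proof.
have e1 j : 0 < simplex_exponent lam j + 1.
  by have [] := simplex_exponentP hn hlam j; lra.
have en j : 0 < simplex_exponent lam j + n%:R + 1 by rewrite addrAC ltr_wpDr.
rewrite /simplex_weight ltr_wpDl//.
  by apply: sumr_ge0 => j _; rewrite divr_ge0 ?ltW ?bary_gt0.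
by rewrite mulr_gt0 ?divr_gt0 ?bary_gt0.
Qed.

Let integrable_bary i :
  nu.-integrable (simplex R n) (fun t => (bary t i)%:E).
Proof.
have mE := @measurable_simplex R n.
apply/integrableP; split.
  by apply/measurable_EFinP; apply: measurable_funTS; exact: measurable_bary.
under eq_integral => t /[!inE] /simplexP t0 do rewrite gee0_abs ?lee_fin//.
by rewrite simplex_measure_bary// ltry.
Qed.

Let integrable_comb (c : 'I_n.+1 -> R) :
  nu.-integrable (simplex R n) (fun t => (\sum_i c i * bary t i)%:E).
Proof.
have mE := @measurable_simplex R n.
under eq_fun do rewrite -sumEFin.
apply: integrable_sum => // i _; under eq_fun do rewrite EFinM.
exact: integrableZl.
Qed.

Let integral_comb (c : 'I_n.+1 -> R) :
  (\int[nu]_(t in simplex R n) (\sum_i c i * bary t i)%R%:E =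
   (\sum_i c i * w i)%R%:E)%E.
Proof.
have mE := @measurable_simplex R n.
under eq_integral do rewrite -sumEFin.
rewrite integral_sum//; last first.
  by move=> i; under eq_fun do rewrite EFinM; exact: integrableZl.
rewrite -sumEFin; apply: eq_bigr => i _.
under eq_integral do rewrite EFinM.
by rewrite integralZl// simplex_measure_bary.
Qed.

(** Obtained by integrating [\sum_i bary t i = 1] against the probability measure. *)
Lemma sum_simplex_weight : \sum_i w i = 1.
Proof.
apply: EFin_inj; rewrite -[RHS](simplex_measure_simplex hn hlam).
have mE := @measurable_simplex R n.
rewrite (eq_bigr (fun i => 1 * w i)) => [|i _]; last by rewrite mul1r.
rewrite -integral_comb.
rewrite -[RHS]mul1e -integral_cst//; apply: eq_integral => t _.
by rewrite (eq_bigr (bary t)) ?sum_bary// => i _; rewrite mul1r.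
Qed.

Lemma hermite_hadamard_simplex (C : set 'rV[R]_n) (f : 'rV[R]_n -> R)
    (a : 'I_n.+1 -> 'rV[R]_n) :
  convex_set C -> convex_function C f -> (forall i, C (a i)) ->
  [/\ nu.-integrable (simplex R n) (fun t => (f (\sum_i bary t i *: a i))%:E),
      ((f (\sum_i w i *: a i))%:E <=
       \int[nu]_(t in simplex R n) (f (\sum_i bary t i *: a i))%:E)%E
    & (\int[nu]_(t in simplex R n) (f (\sum_i bary t i *: a i))%:E <=
       (\sum_i w i * f (a i))%:E)%E].
Proof.
move=> Cc fc Ca; have mE := @measurable_simplex R n.
(* [G] is [f] after a linear map, so it inherits convexity even when the points [a i] are affinely
   dependent. *)
pose G (b : 'rV[R]_n.+1) : R := f (\sum_i b 0 i *: a i).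
have GE t : f (\sum_i bary t i *: a i) = G (bary_row t).
  by congr f; apply: eq_bigr => i _; rewrite mxE.
have Gle b : barycentric b -> G b <= \sum_i b 0 i * f (a i).
  by move=> [b0 b1]; exact: (convex_function_sum Cc fc).
have Gconv (c : R) x y : 0 <= c <= 1 -> barycentric x -> barycentric y ->
    G (c *: x + (1 - c) *: y) <= c * G x + (1 - c) * G y.
  move=> c01 [x0 x1] [y0 y1].
  have -> : G (c *: x + (1 - c) *: y) =
      f (c *: (\sum_i x 0 i *: a i) + (1 - c) *: (\sum_i y 0 i *: a i)).
    congr f; rewrite !scaler_sumr -big_split/=; apply: eq_bigr => i _.
    by rewrite !mxE !scalerA -scalerDl.
  by apply: (convex_function_le fc) => //; exact: convex_set_sum.
pose M := \sum_i `|f (a i)|.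
have GM x : barycentric x -> G x <= M.
  move=> xD; apply: le_trans (Gle _ xD) _; apply: ler_sum => i _.
  apply: le_trans (ler_norm _) _; rewrite normrM ler_piMl//.
  by rewrite ger0_norm ?barycentric_le1//; case: xD.
have [N NG] := barycentric_convex_bounded Gconv GM.
have fint : nu.-integrable (simplex R n) (fun t => (f (\sum_i bary t i *: a i))%:E).
  under eq_fun do rewrite GE.
  apply: measurable_bounded_integrable => //.
  - by rewrite [ltLHS](simplex_measure_simplex hn hlam) ltry.
  - exact: measurable_barycentric_convex Gconv GM.
  - exists (`|M| + `|N|); split; first exact: num_real.
    move=> K MNK t tE /=; have tD := bary_row_barycentric tE.
    rewrite (le_trans _ (ltW MNK))// ler_norml; have := GM _ tD; have := NG _ tD.
    have := ler_norm M; have := ler_norm (- N); rewrite normrN.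
    have := normr_ge0 M; have := normr_ge0 N.
    by move=> *; apply/andP; split; lra.
split=> //.
  pose wr : 'rV[R]_n.+1 := \row_i w i.
  have wD : barycentric wr.
    split=> [i|]; first by rewrite mxE ltW// simplex_weight_gt0.
    by under eq_bigr do rewrite mxE; exact: sum_simplex_weight.
  have [|l [lG lw]] := barycentric_subgradient Gconv wD.
    by move=> i; rewrite mxE simplex_weight_gt0.
  have -> : f (\sum_i w i *: a i) = \sum_i l i * w i.
    transitivity (G wr); first by congr f; apply: eq_bigr => i _; rewrite mxE.
    by rewrite -lw; apply: eq_bigr => i _; rewrite mxE.
  (* A linear form in the barycentric coordinates integrates to its value at the barycenter, where
     the minorant touches [G]. *)
  rewrite -integral_comb; apply: le_integral => //.
  move=> t /[!inE] tE; rewrite lee_fin GE.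
  have := lG _ (bary_row_barycentric tE); apply: le_trans.
  by rewrite le_eqVlt; apply/orP; left; apply/eqP/eq_bigr => i _; rewrite mxE.
under eq_bigr do rewrite mulrC.
rewrite -integral_comb; apply: le_integral => // t /[!inE] tE.
rewrite lee_fin GE (le_trans (Gle _ (bary_row_barycentric tE)))//.
by rewrite le_eqVlt; apply/orP; left; apply/eqP/eq_bigr => i _; rewrite mxE mulrC.
Qed.

End jensen_simplex.
Theorem theorem3p1 (R : realType) (n : nat) (hn : (1 <= n)%N)
    (C : set 'rV[R]_n) (hC0 : C !=set0) (hC : convex_set C)
    (f : 'rV[R]_n -> R)
    (lam : measurable_Rn R n) (hlam : simplex_interior lam) :
  [/\ simplex_measure hlam (simplex R n) = 1%E,
      convex_function C f ->
      forall a : 'I_n.+1 -> 'rV[R]_n, (forall i, C (a i)) ->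
        [/\ (simplex_measure hlam).-integrable (simplex R n)
              (fun t => (f (\sum_(i < n.+1) bary t i *: a i))%:E),
            ((f (\sum_(i < n.+1) simplex_weight lam i *: a i))%:E <=
             \int[simplex_measure hlam]_(t in simplex R n)
               (f (\sum_(i < n.+1) bary t i *: a i))%:E)%E
          & (\int[simplex_measure hlam]_(t in simplex R n)
               (f (\sum_(i < n.+1) bary t i *: a i))%:E <=
             (\sum_(i < n.+1) simplex_weight lam i * f (a i))%:E)%E]
    & concave_function C f ->
      forall a : 'I_n.+1 -> 'rV[R]_n, (forall i, C (a i)) ->
        [/\ (simplex_measure hlam).-integrable (simplex R n)
              (fun t => (f (\sum_(i < n.+1) bary t i *: a i))%:E),
            (\int[simplex_measure hlam]_(t in simplex R n)
               (f (\sum_(i < n.+1) bary t i *: a i))%:E <=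
             (f (\sum_(i < n.+1) simplex_weight lam i *: a i))%:E)%E
          & ((\sum_(i < n.+1) simplex_weight lam i * f (a i))%:E <=
             \int[simplex_measure hlam]_(t in simplex R n)
               (f (\sum_(i < n.+1) bary t i *: a i))%:E)%E]].
Proof.
split; first exact: simplex_measure_simplex.
  by move=> fc a Ca; exact: hermite_hadamard_simplex hC fc Ca.
move=> fc a Ca.
(* The concave case is the convex one for [- f]; integrability of [f] is recovered first, so that
   the sign can leave the integral. *)
have fNc : convex_function C (fun x => - f x).
  by move=> t x y xC yC; rewrite -[leRHS]convN lerN2; exact: fc.
have [Ni] := hermite_hadamard_simplex hn hlam hC fNc Ca.
have fi : (simplex_measure hlam).-integrable (simplex R n)
    (fun t => (f (\sum_(i < n.+1) bary t i *: a i))%:E).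
  rewrite (_ : (fun t => _) =
      (fun t => - (- f (\sum_(i < n.+1) bary t i *: a i))%:E)%E).
    exact: integrableN.
  by apply/funext => t; rewrite -EFinN opprK.
under eq_integral do rewrite EFinN -mulN1e.
rewrite integralZl//; last exact: measurable_simplex.
have -> : \sum_(i < n.+1) simplex_weight lam i * - f (a i) =
    - \sum_(i < n.+1) simplex_weight lam i * f (a i).
  by rewrite -sumrN; apply: eq_bigr => i _; rewrite mulrN.
by rewrite mulN1e !EFinN !leeN2.
Qed.
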